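(* Let $s\ge0$ be an integer and let $\mathcal{R}$ be an $s$-Rota-Baxter operator (of weight $0$) on a regular hom-Lie algebra $(\mathfrak{g},[\cdot,\cdot],\alpha)$. If $R$ generates a linear deformation of $\mathcal{R}$, then $R$ is a $1$-cocycle of the complex $\big(\widetilde{C}^*_{\alpha,\alpha}(\mathfrak{g},\mathfrak{g}),\delta_{\alpha,\alpha}\big)$. Moreover, if two linear deformations of $\mathcal{R}$ generated by $R_1$ and $R_2$ are equivalent, then $R_1$ and $R_2$ determine the same cohomology class.
   Context: The base field $k$ has characteristic zero. A (multiplicative) hom-Lie algebra $(\mathfrak{g},[\cdot,\cdot],\alpha)$ is a vector space $\mathfrak{g}$ with a skew-symmetric bilinear bracket and a linear map $\alpha:\mathfrak{g}\to\mathfrak{g}$ with $\alpha[x,y]=[\alpha(x),\alpha(y)]$ and $[\alpha(x),[y,z]]+[\alpha(y),[z,x]]+[\alpha(z),[x,y]]=0$; it is regular if $\alpha$ is invertible. An $s$-Rota-Baxter operator of weight $0$ is a linear map $\mathcal{R}:\mathfrak{g}\to\mathfrak{g}$ with $\mathcal{R}\circ\alpha=\alpha\circ\mathcal{R}$ and $[\mathcal{R}(x),\mathcal{R}(y)]=\mathcal{R}([\alpha^s\mathcal{R}(x),y]+[x,\alpha^s\mathcal{R}(y)])$ for all $x,y\in\mathfrak{g}$. Equivalently, it is an $\mathcal{O}$-operator with respect to the representation $(\mathfrak{g},\alpha,\rho_s)$, $\rho_s(x)(y)=[\alpha^s(x),y]$. Put $[x,y]_{\mathcal{R}}=[\alpha^s\mathcal{R}x,y]+[x,\alpha^s\mathcal{R}y]$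 and $\rho_{\mathcal{R}}(x)(y)=[\mathcal{R}x,y]+\mathcal{R}[\alpha^s(y),x]$. The complex $\widetilde{C}^*_{\alpha,\alpha}(\mathfrak{g},\mathfrak{g})=\bigoplus_{n\ge0}C^n$ has $C^0=\{x\in\mathfrak{g}\mid\alpha(x)=x\}$ and, for $n\ge1$, $C^n$ the space of linear maps $P:\wedge^n\mathfrak{g}\to\mathfrak{g}$ with $\alpha(P(x_1,\dots,x_n))=P(\alpha(x_1),\dots,\alpha(x_n))$. The differential $\delta_{\alpha,\alpha}$ is $\delta_{\alpha,\alpha}(x)(y)=\rho_{\mathcal{R}}(\alpha^{-1}(y))(x)$ for $x\in C^0$, and for $P\in C^n$, $n\ge1$, $$\delta_{\alpha,\alpha}P(x_1,\dots,x_{n+1})=\sum_{i=1}^{n+1}(-1)^{i+1}\rho_{\mathcal{R}}(\alpha^{n-1}(x_i))\big(P(x_1,\dots,\widehat{x_i},\dots,x_{n+1})\big)+\sum_{i<j}(-1)^{i+j}P\big([x_i,x_j]_{\mathcal{R}},\alpha(x_1),\dots,\widehat{\alpha(x_i)},\dots,\widehat{\alpha(x_j)},\dots,\alpha(x_{n+1})\big).$$ A linear operator $R:\mathfrak{g}\to\mathfrak{g}$ generates a linear deformation of $\mathcal{R}$ if $\mathcal{R}_t=\mathcal{R}+tR$ is an $s$-Rota-Baxter operator (of weight $0$) on $(\mathfrak{g},[\cdot,\cdot],\alpha)$ for all $t\in k$. Put $\mathrm{ad}_x^\dagger(y)=\alpha^{-1}[x,y]$ and $\rho_s(x)^\dagger(y)=\alpha^{-1}[\alpha^sx,y]$.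 Two linear deformations $\mathcal{R}^1_t=\mathcal{R}+tR_1$ and $\mathcal{R}^2_t=\mathcal{R}+tR_2$ are equivalent if there is $x\in\mathfrak{g}$ with $\alpha(x)=x$ such that $(\phi,\psi)=(\mathrm{Id}_{\mathfrak{g}}+t\,\mathrm{ad}_x^\dagger,\mathrm{Id}_{\mathfrak{g}}+t\rho_s(x)^\dagger)$ is a homomorphism from $\mathcal{R}^2_t$ to $\mathcal{R}^1_t$ (for all $t$), i.e. $\phi$ is a hom-Lie algebra homomorphism (preserves the bracket and commutes with $\alpha$), $\mathcal{R}^1_t\circ\psi=\phi\circ\mathcal{R}^2_t$, $\psi\circ\alpha=\alpha\circ\psi$, and $\psi(\rho_s(y)(z))=\rho_s(\phi(y))(\psi(z))$ for all $y,z\in\mathfrak{g}$. *)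

(* Defs.v *)
From mathcomp Require Import all_boot all_algebra.

Set Implicit Arguments.
Unset Strict Implicit.
Unset Printing Implicit Defensive.

Import GRing.Theory.
Local Open Scope ring_scope.

(* The inverse of the twist is data; it is unique, so this is the same as
   asking the twist to be bijective. *)
Record regHomLie (k : fieldType) (g : lmodType k) := RegHomLie {
  br : {bilinear g -> g -> g};
  tw : {linear g -> g};
  twV : g -> g;
  br_skew : forall x y, br x y = - br y x;
  tw_br : forall x y, tw (br x y) = br (tw x) (tw y);
  hom_Jacobi : forall x y z,
    br (tw x) (br y z) + br (tw y) (br z x) + br (tw z) (br x y) = 0;
  twK : cancel tw twV;
  twVK : cancel twV tw
}.

Section RotaBaxter.
Context (k : fieldType) (g : lmodType k) (L : regHomLie g) (s : nat).

Local Notation br := (br L).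
Local Notation alpha := (tw L).
Local Notation alphaV := (twV L).
Local Notation "alpha^( n )" := (iter n alpha) (format "alpha^( n )").

Definition rotaBaxter (T : {linear g -> g}) : Prop :=
  (forall x, T (alpha x) = alpha (T x)) /\
  (forall x y, br (T x) (T y) =
     T (br (alpha^(s) (T x)) y + br x (alpha^(s) (T y)))).

Definition deform (T R : {linear g -> g}) (t : k) : {linear g -> g} :=
  T \+ t \*: R.

Definition generates_deformation (T R : {linear g -> g}) : Prop :=
  forall t : k, rotaBaxter (deform T R t).

Definition rho (x y : g) : g := br (alpha^(s) x) y.

Definition ad_dag (x y : g) : g := alphaV (br x y).
Definition rho_dag (x y : g) : g := alphaV (rho x y).

Definition homLie_morphism (phi : g -> g) : Prop :=
  [/\ linear phi,
      forall x y, phi (br x y) = br (phi x) (phi y) &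
      forall x, phi (alpha x) = alpha (phi x)].

(* (phi, psi) is a homomorphism from T2 to T1, both being seen as
   O-operators with respect to the representation (g, alpha, rho). *)
Definition RB_morphism (T2 T1 : {linear g -> g}) (phi psi : g -> g) : Prop :=
  [/\ homLie_morphism phi /\ linear psi,
      forall y, T1 (psi y) = phi (T2 y),
      forall y, psi (alpha y) = alpha (psi y) &
      forall y z, psi (rho y z) = rho (phi y) (psi z)].

Definition equivalent_deformations (T R1 R2 : {linear g -> g}) : Prop :=
  exists2 x : g, alpha x = x &
    forall t : k, RB_morphism (deform T R2 t) (deform T R1 t)
      (fun y => y + t *: ad_dag x y) (fun y => y + t *: rho_dag x y).

Section Complex.
Variable T : {linear g -> g}.

Definition brT (x y : g) : g :=
  br (alpha^(s) (T x)) y + br x (alpha^(s) (T y)).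

Definition rhoT (x y : g) : g := br (T x) y + T (br (alpha^(s) y) x).

(* Underlying functions of n-cochains: elements of g for n = 0, functions of
   n variables for n > 0.  Linear maps on the n-th exterior power are encoded
   as alternating multilinear maps (see [cochain]). *)
Definition precochain (n : nat) : Type :=
  if n is 0 then g else {ffun 'I_n -> g} -> g.

Definition upd n (x : {ffun 'I_n -> g}) (i : 'I_n) (v : g) : {ffun 'I_n -> g} :=
  [ffun j => if j == i then v else x j].

Definition multilinear n (P : {ffun 'I_n -> g} -> g) : Prop :=
  forall (x : {ffun 'I_n -> g}) (i : 'I_n), linear (fun v => P (upd x i v)).

Definition alternating n (P : {ffun 'I_n -> g} -> g) : Prop :=
  forall (x : {ffun 'I_n -> g}) (i j : 'I_n), i != j -> x i = x j -> P x = 0.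

Definition cochain (n : nat) : precochain n -> Prop :=
  match n with
  | 0 => fun x => alpha x = x
  | n'.+1 => fun P =>
      [/\ multilinear P, alternating P &
          forall x, alpha (P x) = P [ffun i => alpha (x i)]]
  end.

Definition omit1 n (x : {ffun 'I_n.+1 -> g}) (i : 'I_n.+1) : {ffun 'I_n -> g} :=
  [ffun l => x (lift i l)].

(* For i < j, l |-> bump j (bump i l) is the increasing enumeration of the
   indices other than i and j. *)
Definition omit2 n (x : {ffun 'I_n.+2 -> g}) (i j : 'I_n.+2) :
    {ffun 'I_n -> g} :=
  [ffun l : 'I_n => x (inord (bump j (bump i l)))].

Definition prepend n (v : g) (x : {ffun 'I_n -> g}) : {ffun 'I_n.+1 -> g} :=
  [ffun l => if unlift ord0 l is Some l' then x l' else v].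

(* Indices start at 0, so the sign (-1)^(i+1) of the usual formula becomes
   (-1)^i, while (-1)^(i+j) is unchanged. *)
Definition delta (n : nat) : precochain n -> precochain n.+1 :=
  match n with
  | 0 => fun x y => rhoT (alphaV (y ord0)) x
  | m.+1 => fun P x =>
      \sum_(i < m.+2) (-1) ^+ i *: rhoT (alpha^(m) (x i)) (P (omit1 x i)) +
      \sum_(i < m.+2) \sum_(j < m.+2 | (i < j)%N)
        (-1) ^+ (i + j) *:
          P (prepend (brT (x i) (x j)) [ffun l => alpha (omit2 x i j l)])
  end.

Definition cocycle (n : nat) (P : precochain n) : Prop :=
  cochain P /\ forall x, delta P x = 0.

(* There is nothing below degree 0, so the only 0-coboundary is 0. *)
Definition coboundary (n : nat) : precochain n -> Prop :=
  match n with
  | 0 => fun x => x = 0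
  | m.+1 => fun P =>
      exists2 Q : precochain m, cochain Q & forall x, P x = delta Q x
  end.

Definition precochain_sub (n : nat) : precochain n -> precochain n -> precochain n :=
  match n with
  | 0 => fun x y => x - y
  | m.+1 => fun P Q x => P x - Q x
  end.

Definition same_class (n : nat) (P Q : precochain n) : Prop :=
  [/\ cocycle P, cocycle Q & coboundary (precochain_sub P Q)].

End Complex.

Definition cochain1 (R : g -> g) : precochain 1 := fun x => R (x ord0).

End RotaBaxter.

(* Main.v *)
(* Both defining identities are polynomial of degree 2 in the parameter t, so,
   2 being invertible, comparing their values at t = 1 and t = -1 gives the
   equality of the coefficients of t.  For the Rota-Baxter identity this
   coefficient is the cocycle condition on R; for the intertwining identity
   it reads R1 - R2 = delta (- x). *)
Require Import Defs.
From mathcomp Require Import all_boot all_algebra.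
Import GRing.Theory.
Local Open Scope ring_scope.

Lemma quadratic_eq_coef1 (k : fieldType) (V : lmodType k)
    (u0 u1 u2 v0 v1 v2 : V) : (2 : k) != 0 ->
  (forall t : k, u0 + t *: u1 + (t * t) *: u2 = v0 + t *: v1 + (t * t) *: v2) ->
  u1 = v1.
Proof.
move=> two_neq0 quadE.
have := congr2 (fun a b => a - b) (quadE 1) (quadE (-1)).
have diffE (w0 w1 w2 : V) : w0 + 1 *: w1 + (1 * 1) *: w2 -
    (w0 + (-1) *: w1 + ((-1) * (-1)) *: w2) = 2 *: w1.
  by rewrite mulrNN opprD addrACA subrr addr0 opprD addrACA subrr add0r
             scaleN1r opprK scale1r -mulr2n scaler_nat.
by rewrite !diffE => /(scalerI two_neq0).
Qed.

(** Regroups what linearity produces, an affine expression in [t] plus [t] times another one, into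
    the polynomial form that [quadratic_eq_coef1] expects. *)
Lemma quadratic_expand (k : fieldType) (V : lmodType k) (a b c d : V) (t : k) :
  (a + t *: b) + t *: (c + t *: d) = a + t *: (b + c) + (t * t) *: d.
Proof. by rewrite !scalerDr scalerA !addrA. Qed.

Lemma deform_quadratic (k : fieldType) (V : lmodType k)
    (T R : {linear V -> V}) (t : k) u v :
  deform T R t (u + t *: v) = T u + t *: (T v + R u) + (t * t) *: R v.
Proof.
by rewrite /deform /= (linearD T) (linearD R) !linearZ_LR quadratic_expand.
Qed.

Section HomLie.
Context (k : fieldType) (g : lmodType k) (L : regHomLie g) (s : nat).
Local Notation br := (br L).
Local Notation alpha := (tw L).
Local Notation alphaV := (twV L).

Lemma iter_tw_linear n : linear (iter n alpha).
Proof. by elim: n => [|n IHn] a x y //=; rewrite IHn linearP. Qed.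

Lemma iter_tw_fix n x : alpha x = x -> iter n alpha x = x.
Proof. by move=> xfix; elim: n => //= n ->. Qed.

Lemma twV_linear : linear alphaV.
Proof.
by move=> a x y; apply: (can_inj (twK L)); rewrite linearP /= !(twVK L).
Qed.

Lemma twV_br x y : alphaV (br x y) = br (alphaV x) (alphaV y).
Proof. by apply: (can_inj (twK L)); rewrite tw_br !(twVK L). Qed.

Lemma twV_comm (f : g -> g) :
  (forall x, f (alpha x) = alpha (f x)) -> forall x, f (alphaV x) = alphaV (f x).
Proof. by move=> fC x; apply: (can_inj (twK L)); rewrite -fC !(twVK L). Qed.

(** The bracket depends linearly on the operator, hence is affine in [t] along a deformation.
    Applying the deformed operator to it makes the right side of the Rota-Baxter identity
    quadratic. *)
Lemma deform_brT (T R : {linear g -> g}) (t : k) x y :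
  brT L s (deform T R t) x y = brT L s T x y + t *: brT L s R x y.
Proof.
have iterE v w : iter s alpha (v + t *: w) = iter s alpha v + t *: iter s alpha w.
  by rewrite addrC iter_tw_linear addrC.
rewrite /brT /deform /= !iterE linearDl linearDr linearZl_LR linearZ_LR /=.
by rewrite addrACA -scalerDr.
Qed.

Section Cocycle.
Context (T : {linear g -> g}) (hT : rotaBaxter L s T).
Context (two_neq0 : (2 : k) != 0).

(** At [t = 1], [T + R] commutes with the twist, and so does [T]; cancel the latter. *)
Lemma generates_deformation_tw (R : {linear g -> g}) :
  generates_deformation L s T R -> forall x, R (alpha x) = alpha (R x).
Proof.
move=> hR x; have [/(_ x) + _] := hR 1.
by rewrite /deform /= !scale1r linearD hT.1 => /addrI.
Qed.

Lemma generates_deformation_coef1 (R : {linear g -> g}) :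
  generates_deformation L s T R -> forall x y,
  br (T x) (R y) + br (R x) (T y) = T (brT L s R x y) + R (brT L s T x y).
Proof.
move=> hR x y.
apply: (@quadratic_eq_coef1 _ _ (br (T x) (T y)) _ (br (R x) (R y))
  (T (brT L s T x y)) _ (R (brT L s R x y)) two_neq0) => t.
have [_ /(_ x y)] := hR t.
rewrite -/(brT L s (deform T R t) x y) deform_brT deform_quadratic /deform /=.
(* The right side is now polynomial in [t]; it remains to expand the left one by bilinearity. *)
rewrite [br (_ + _) _]linearDl 2![br _ (_ + _)]linearDr.
rewrite !linearZl_LR !linearZ_LR /=.
by rewrite -[t *: br (R x) _ + _]scalerDr quadratic_expand.
Qed.

(** With a single variable, multilinearity is linearity and alternation is vacuous, so only
    compatibility with the twist has content. *)
Lemma cochain_cochain1 (R : {linear g -> g}) :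
  (forall x, R (alpha x) = alpha (R x)) -> cochain L (cochain1 R).
Proof.
move=> RC; split=> [x i|x i j|x]; rewrite /cochain1.
- by move=> a u v; rewrite !ffunE (ord1 i) eqxx linearP.
- by rewrite (ord1 i) (ord1 j) eqxx.
- by rewrite ffunE RC.
Qed.

(** Skew-symmetry turns the two [rhoT] terms into the brackets of [T] with [R] minus
    [T (brT L s R _ _)]. The result is the difference of the two sides of
    [generates_deformation_coef1]. *)
Lemma delta_cochain1 (R : {linear g -> g}) (x : {ffun 'I_2 -> g}) :
  delta L s T (cochain1 R : precochain g 1) x =
    br (T (x ord0)) (R (x ord_max)) + br (R (x ord0)) (T (x ord_max)) -
    (T (brT L s R (x ord0) (x ord_max)) + R (brT L s T (x ord0) (x ord_max))).
Proof.
have -> : ord_max = lift ord0 ord0 :> 'I_2 by apply: val_inj.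
rewrite /delta /cochain1 !big_ord_recl !big_ord0.
(* Both inner sums are made unconditional so that they unroll; only the pair (0, 1) survives. *)
rewrite big_mkcond [\sum_(j < 2 | (lift ord0 ord0 < j)%N) _]big_mkcond /=.
rewrite !big_ord_recl !big_ord0 /= !ffunE unlift_none.
have -> : lift (lift ord0 ord0) ord0 = ord0 :> 'I_2 by apply: val_inj.
rewrite !addr0 !add0r !expr0 !expr1 !scaleN1r !scale1r /rhoT.
rewrite [br (iter _ _ _) (x ord0)]br_skew [br _ (R (x ord0))]br_skew.
rewrite [brT L s R _ _]/brT (linearD T) linearN.
set A := br (T _) _; set B := br (R _) _; set C := T (br (x _) _).
set D := T (br _ _); set E := R _.
by rewrite !opprD opprK !addrA (addrAC A) (addrAC _ (- C)).
Qed.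

Lemma generates_deformation_cocycle (R : {linear g -> g}) :
  generates_deformation L s T R -> cocycle L s T (cochain1 R).
Proof.
move=> hR; split; first exact/cochain_cochain1/generates_deformation_tw.
by move=> x; rewrite delta_cochain1 generates_deformation_coef1 // subrr.
Qed.

Lemma equivalent_deformations_coef1 (R1 R2 : {linear g -> g}) :
  equivalent_deformations L s T R1 R2 ->
  exists2 x : g, alpha x = x & forall y,
    T (rho_dag L s x y) + R1 y = R2 y + ad_dag L x (T y).
Proof.
case=> x xfix morph; exists x => // y.
have adE u v t : ad_dag L x (u + t *: v) = ad_dag L x u + t *: ad_dag L x v.
  by rewrite /ad_dag linearDr linearZ_LR /= addrC twV_linear addrC.
apply: (@quadratic_eq_coef1 _ _ (T y) _ (R1 (rho_dag L s x y))
  (T y) _ (ad_dag L x (R2 y)) two_neq0) => t.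
have [_ /(_ y) + _ _] := morph t.
by rewrite deform_quadratic /deform /= adE quadratic_expand.
Qed.

(** As [x] is fixed by the twist, its inverse and its powers, [alphaV] can be pulled out of both
    brackets of [rhoT]. Skew-symmetry flips one bracket, which is why the sign is right for [- x]
    and not for [x]. *)
Lemma delta0_opp x y : alpha x = x ->
  delta L s T (- x : precochain g 0) y =
    ad_dag L x (T (y ord0)) - T (rho_dag L s x (y ord0)).
Proof.
move=> xfix; have xfixV : alphaV x = x by rewrite -{1}xfix twK.
rewrite /= /rhoT /ad_dag /rho_dag /rho (iter_tw_fix _ _ xfix).
rewrite (iter_tw_fix _ (- x)) ?linearN ?xfix // !twV_br xfixV (twV_comm _ hT.1).
by rewrite [br x (alphaV _)]br_skew linearNl !linearN.
Qed.

End Cocycle.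
End HomLie.

Theorem proposition5p4 (k : fieldType) (char0 : [pchar k] =i pred0)
    (g : lmodType k) (L : regHomLie g) (s : nat) (T : {linear g -> g})
    (hT : rotaBaxter L s T) :
  (forall R : {linear g -> g},
      generates_deformation L s T R -> cocycle L s T (cochain1 R)) /\
  (forall R1 R2 : {linear g -> g},
      generates_deformation L s T R1 ->
      generates_deformation L s T R2 ->
      equivalent_deformations L s T R1 R2 ->
      same_class L s T (cochain1 R1) (cochain1 R2)).
Proof.
(* 2 is prime, so its absence from [[pchar k]] says that it is nonzero in [k]. *)
have two_neq0 : (2 : k) != 0 by have := char0 2%N; rewrite inE /= => /negbT.
have cocycleR := generates_deformation_cocycle _ _ _ _ _ hT two_neq0.
split=> // R1 R2 hR1 hR2 /equivalent_deformations_coef1-/(_ two_neq0)[x xfix R12].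
split; [exact: cocycleR | exact: cocycleR | exists (- x : precochain g 0)].
  by rewrite /= linearN xfix.
move=> y; rewrite delta0_opp // /cochain1 /=; apply/eqP.
(* Moving the subtracted terms across leaves the identity [R12]. *)
by rewrite subr_eq addrAC eq_sym subr_eq addrC -R12 addrC.
Qed.
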